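(* For every $\lambda\in\mathbb R_+$, every $n\ge1$ and every sample of indices $X=(x\langle1\rangle,\dots,x\langle n\rangle)\in\mathcal R^n$, we have $$\mathsf R(\mathcal C_\lambda)\le\mathsf W(\mathcal C_\lambda)\le 2\lambda\sqrt{\rho/n},$$ where $\mathsf R(\cdot)$ and $\mathsf W(\cdot)$ are the Rademacher and worst case Rademacher complexities.
   Context: Fix an order $p\ge1$ and dimensions $r_1,\dots,r_p\ge1$; $[s]=\{1,\dots,s\}$, $\mathcal R=[r_1]\times\cdots\times[r_p]$, and $\rho=\sum_{i=1}^p r_i$. For a tensor $\psi\in\mathbb R^{r_1\times\cdots\times r_p}$ and $x=(x_1,\dots,x_p)\in\mathcal R$, $\psi_x$ denotes the entry with indices $x$. For $\lambda\in\mathbb R_+$ let $$\mathcal S_\lambda=\Big\{\psi:\ \exists\,\theta^{(k)}\in\{-1,1\}^{r_k}\ (k\in[p])\text{ with }\psi_x=\lambda\prod_{k=1}^p\theta^{(k)}_{x_k}\ \forall x\in\mathcal R\Big\},\qquad\mathcal C_\lambda=\mathrm{conv}(\mathcal S_\lambda).$$ Let $\sigma_1,\dots,\sigma_n$ be i.i.d. Rademacher random variables ($\pm1$ with probability $\frac12$ each). For the sample $X$, $$\mathsf R(\mathcal C_\lambda)=\mathbb E_\sigma\Big(\sup_{\psi\in\mathcal C_\lambda}\frac1n\Big|\sum_{i=1}^n\sigma_i\psi_{x\langle i\rangle}\Big|\Big),\qquad \mathsf W(\mathcal C_\lambda)=\sup_{X\in\mathcal R^n}\mathbb E_\sigma\Big(\sup_{\psi\in\mathcal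 C_\lambda}\frac1n\Big|\sum_{i=1}^n\sigma_i\psi_{x\langle i\rangle}\Big|\Big).$$ *)

(* Defs.v *)
From HB Require Import structures.
From mathcomp Require Import all_boot all_order all_algebra.
From mathcomp Require Import all_classical all_reals all_analysis.

Set Implicit Arguments.
Unset Strict Implicit.
Unset Printing Implicit Defensive.

Import Order.TTheory GRing.Theory Num.Theory.
Import numFieldNormedType.Exports.

Local Open Scope classical_set_scope.
Local Open Scope ring_scope.

Section Tensors.
Context {R : realType} {p : nat}.
Implicit Type r : 'I_p -> nat.

Definition multi_index r := {dffun forall k : 'I_p, 'I_(r k)}.

Definition tensor r := {ffun multi_index r -> R}.

Definition sign_tensors r (lambda : R) : set (tensor r) :=
  [set psi | exists theta : forall k : 'I_p, 'I_(r k) -> R,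
     (forall k i, theta k i = -1 \/ theta k i = 1) /\
     (forall x : multi_index r, psi x = lambda * \prod_(k < p) theta k (x k))].

Arguments sign_tensors r lambda : clear implicits.

(* The convex hull: the smallest convex set containing the sign tensors, for the
   entrywise vector space structure on finite functions. *)
Definition sign_tensor_hull r (lambda : R) : set (tensor r) :=
  smallest (fun K : set (convex_lmodType (tensor r)) => convex_set K)
    (sign_tensors r lambda).

End Tensors.

Arguments tensor R {p} r.
Arguments sign_tensors {R p} r lambda.
Arguments sign_tensor_hull {R p} r lambda.

Section Rademacher.
Local Open Scope ereal_scope.
Context {d : measure_display} {Omega : measurableType d} {R : realType}
  {P : probability Omega R} {n : nat}.
Implicit Type sigma : 'I_n -> {RV P >-> R}.

Definition mutually_independent sigma : Prop :=
  forall (J : {set 'I_n}) (B : 'I_n -> set R),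
    (forall i, i \in J -> measurable (B i)) ->
    P (\bigcap_(i in [set` J]) (sigma i @^-1` B i)) =
    \prod_(i in J) P (sigma i @^-1` B i).

Definition rademacher_variable (X : {RV P >-> R}) : Prop :=
  P [set w | X w = 1%R] = (2^-1)%:E /\ P [set w | X w = (-1)%R] = (2^-1)%:E.

Definition iid_rademacher sigma : Prop :=
  mutually_independent sigma /\ forall i, rademacher_variable (sigma i).

Section Complexity.
Context {p : nat} {r : 'I_p -> nat}.
Implicit Types (F : set (tensor R r)) (X : 'I_n -> multi_index r).

(* The supremum and the expectation are taken in the extended reals, so that no
   boundedness or integrability is presupposed of F. *)
Definition rademacher_complexity sigma F X : \bar R :=
  \int[P]_w ereal_sup
    [set (n%:R^-1 * `|\sum_(i < n) sigma i w * psi (X i)|)%R%:E | psi in F].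

Definition worst_case_complexity sigma F : \bar R :=
  ereal_sup [set rademacher_complexity sigma F X | X in setT].

End Complexity.
End Rademacher.

(* Main.v *)
(* Massart's finite class argument.  A seminorm has the same supremum over the
   hull as over the sign tensors, which are at most 2^rho in number.  Writing W_t
   for the correlation of the signs with the pattern t, for all u > 0 and L
     u max_t |W_t| - L <= sum_t (exp (u W_t) + exp (- u W_t)) exp (- L) - 1,
   and cosh u <= exp (u^2 / 2) bounds the mean of the right-hand side by
   2^(rho+1) exp (n u^2 / 2 - L) - 1.  This is nonpositive for
   u = 2 sqrt (rho / n) and L = 4 rho, whence E max_t |W_t| <= L / u = 2 sqrt (rho n). *)
Require Import Defs.
From mathcomp Require Import all_boot all_order all_algebra.
From mathcomp Require Import all_classical all_reals all_analysis.
From mathcomp Require Import measurable_realfun ring lra.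

Set Implicit Arguments.
Unset Strict Implicit.
Unset Printing Implicit Defensive.

Import Order.TTheory GRing.Theory Num.Theory.
Import numFieldNormedType.Exports.

Local Open Scope classical_set_scope.
Local Open Scope ring_scope.

(** In the sum of the two exponential series the odd terms cancel, and [2 ^ k * k! <= (2 * k)!]
    compares the even ones with the series of [expR (u ^+ 2 / 2)]. *)
Lemma expR_half_sum_le (R : realType) (u : R) :
  expR u + expR (- u) <= 2 * expR (u ^+ 2 / 2).
Proof.
have even_fact k : (2 ^ k * k`! <= (2 * k)`!)%N.
  elim: k => // k IHk; rewrite mulnS add2n !factS expnS.
  have -> : (2 * 2 ^ k * (k.+1 * k`!) = (2 * k).+2 * (2 ^ k * k`!))%N.
    by rewrite -[(2 * k).+2]addn2 -[X in (_ + X)%N]muln1 -mulnDr addn1 mulnACA.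
  by rewrite leq_mul2l /= (leq_trans IHk)// leq_pmull.
pose s v m : R := series (exp_coeff v) m.
have s_even m : s u (2 * m)%N + s (- u) (2 * m)%N =
    2 * \sum_(0 <= k < m) (u ^+ 2) ^+ k / (2 * k)`!%:R.
  rewrite /s /series /=; elim: m => [|m IHm].
    by rewrite muln0 !big_geq// addr0 mulr0.
  rewrite [in RHS]big_nat_recr//= mulrDr -IHm mulnS add2n !big_nat_recr//=.
  rewrite /exp_coeff /= ![_ ^+ (2 * m).+1]exprS
    ![_ ^+ (2 * m)]exprM sqrrN.
  move: (\sum_(_ <= _ < _) _) (\sum_(_ <= _ < _) _) ((u ^+ 2) ^+ m) => a b c.
  move: (_%:R^-1) (_%:R^-1) => f g.
  by ring.
(* Moves the truncation to the even cut [2 * m], where [s_even] applies: the added terms vanish for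
   odd [k] and are nonnegative for even [k]. *)
have s_incr m : s u m + s (- u) m <= s u (2 * m)%N + s (- u) (2 * m)%N.
  rewrite -!big_split /= [leRHS](@big_cat_nat _ _ _ m)//=; last by rewrite leq_pmull.
  rewrite lerDl sumr_ge0// => k _; rewrite /exp_coeff /= -mulrDl divr_ge0//.
  have [odd_k|even_k] := boolP (odd k).
    by rewrite exprNn -signr_odd odd_k mulN1r subrr.
  by rewrite addr_ge0// exprn_even_ge0.
(* The even parts compare term by term, by [even_fact]. *)
have s_le m : s u m + s (- u) m <= 2 * expR (u ^+ 2 / 2).
  rewrite (le_trans (s_incr m))// s_even ler_pM2l//.
  have cvg_s := is_cvg_series_exp_coeff (u ^+ 2 / 2).
  apply: le_trans (nondecreasing_cvgn_le _ cvg_s m); last first.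
    apply/nondecreasing_series => k _ _; rewrite /exp_coeff /=.
    by rewrite divr_ge0// exprn_ge0// divr_ge0// sqr_ge0.
  apply: ler_sum => k _; rewrite /exp_coeff /= expr_div_n -mulrA -invfM.
  apply: ler_wpM2l; first by rewrite exprn_ge0// sqr_ge0.
  rewrite lef_pV2 ?posrE ?ltr0n ?fact_gt0//.
    by rewrite -natrX -natrM ler_nat.
rewrite /expR -limD; [|exact: is_cvg_series_exp_coeff..].
apply: limr_le; first by apply: is_cvgD; exact: is_cvg_series_exp_coeff.
by near=> m; exact: s_le.
Unshelve. all: by end_near. Qed.

(* Unlike [ge0_le_integral], no measurability of [f] is required. *)
Lemma integral_le_nonneg d (T : measurableType d) (R : realType)
    (mu : {measure set T -> \bar R}) (f g : T -> \bar R) :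
  (forall x, 0 <= g x)%E -> (forall x, f x <= g x)%E ->
  (\int[mu]_x f x <= \int[mu]_x g x)%E.
Proof.
move=> g0 fg; have fp x : (0 <= f^\+ x)%E by rewrite funeposE le_max lexx orbT.
have fpg x : (f^\+ x <= g x)%E by rewrite funeposE ge_max fg g0.
rewrite integralE (@le_trans _ _ (\int[mu]_x f^\+ x)%E)//.
  by rewrite geeDl// oppe_le0 integral_ge0.
rewrite !ge0_integralTE//; apply: ereal_sup_le => _ [h /= hf <-].
by exists h => //= x; exact: le_trans (hf x) (fpg x).
Qed.

Section RademacherPatterns.
Context d (Omega : measurableType d) (R : realType) (P : probability Omega R).
Context (n : nat) (sigma : 'I_n -> {RV P >-> R}).
Hypothesis sigma_iid : iid_rademacher sigma.
Implicit Type e : {ffun 'I_n -> bool}.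

Let event e :=
  \bigcap_(i in [set` [set: 'I_n]%SET]) sigma i @^-1` [set (-1) ^+ e i].

Let eventP e w : event e w <-> forall i, sigma i w = (-1) ^+ e i.
Proof.
by split=> [ew i|ew i _]; [apply: ew; rewrite /= inE|exact: ew].
Qed.

Let measurable_event e : measurable (event e).
Proof.
apply: fin_bigcap_measurable => [|i _]; first exact: finite_finset.
by rewrite -[_ @^-1` _]setTI; exact: measurable_funP.
Qed.

Let probability_event e : P (event e) = (2^-1 ^+ n)%:E.
Proof.
rewrite /event sigma_iid.1// (eq_bigr (fun=> 2^-1%:E)) => [|i _]; last first.
  by have [h1 hN1] := sigma_iid.2 i; case: (e i).
by rewrite prodEFin prodr_const cardsT card_ord.
Qed.

Let trivIset_event : trivIset setT event.
Proof.
move=> e1 e2 _ _ [w [/eventP e1w /eventP e2w]]; apply/ffunP => i.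
by apply: (@signr_inj R); rewrite -e1w -e2w.
Qed.

(** There are [2 ^ n] disjoint patterns of mass [2^-1 ^+ n] each, so almost surely the signs form
    one of them. *)
Let probability_events : P (\bigcup_e event e) = 1%E.
Proof.
rewrite measure_fin_bigcup; [|exact: finite_finset|exact: trivIset_event|].
  2: by move=> e _; exact: measurable_event.
rewrite fsbig_finite/=; last exact: finite_finset.
rewrite (eq_bigr (fun=> (2^-1 ^+ n)%:E)) => [|e _];
  last exact: probability_event.
rewrite sumEFin; congr _%:E.
rewrite (perm_big (index_enum {ffun 'I_n -> bool}))/=; last first.
  apply: uniq_perm; rewrite ?finmap.fset_uniq ?index_enum_uniq// => e.
  by rewrite mem_index_enum in_fset_set; [rewrite in_setT|exact: finite_finset].
rewrite sumr_const card_ffun card_bool card_ord -[LHS]mulr_natr natrX -exprMn.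
by rewrite mulVf// expr1n.
Qed.

(** Replaces an expectation over [Omega] by an average over sign patterns. Only a bound on each
    pattern enters, so [f] can be a supremum over the whole hull. *)
Lemma rademacher_integral_le (f : Omega -> \bar R) (c : {ffun 'I_n -> bool} -> R) :
  (forall e, 0 <= c e) ->
  (forall w e, (forall i, sigma i w = (-1) ^+ e i) -> (f w <= (c e)%:E)%E) ->
  (\int[P]_w f w <= (2^-1 ^+ n * \sum_e c e)%:E)%E.
Proof.
move=> c0 fc; pose N := ~` \bigcup_e event e.
have mE : measurable (\bigcup_e event e).
  by apply: fin_bigcup_measurable => // ; exact: finite_finset.
have mN : measurable N by exact: measurableC.
have PN : P N = 0%E by rewrite probability_setC// probability_events subee.
pose g w := (\sum_e (c e)%:E * (\1_(event e) w)%:E)%E.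
have g0 e w : (0 <= (c e)%:E * (\1_(event e) w)%:E)%E.
  by rewrite mule_ge0// lee_fin.
have m1 A : measurable A -> measurable_fun [set: Omega] (fun w => (\1_A w)%:E : \bar R).
  by move=> mA; apply/measurable_EFinP; exact: measurable_indic.
have mg e : measurable_fun setT (fun w => (c e)%:E * (\1_(event e) w)%:E)%E.
  by apply: emeasurable_funM => //; exact: m1.
(* [f] is unconstrained, hence bounded by [+oo], on the null event [N]. *)
apply: (@le_trans _ _ (\int[P]_w (g w + +oo * (\1_N w)%:E))%E).
  have G0 w : (0 <= g w)%E by exact: sume_ge0.
  have N0 w : (0 <= +oo * (\1_N w)%:E :> \bar R)%E by rewrite mule_ge0// lee_fin.
  apply: integral_le_nonneg => w; first by rewrite adde_ge0.
  have [[e _ ew]|Nw] := pselect ((\bigcup_e event e) w).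
    apply: le_trans (fc w e _) _; first exact/eventP.
    rewrite (@le_trans _ _ (g w))//; last by rewrite leeDl.
    rewrite /g (bigD1 e)//= indicE mem_set// mule1 leeDl//.
    by apply: sume_ge0 => e1 _; exact: g0.
  rewrite indicE mem_set// mule1 addey ?leey//.
  by apply/eqP => gNy; move: (G0 w); rewrite gNy.
rewrite ge0_integralD//=; last first.
- by apply: emeasurable_funM => //; exact: m1.
- exact: emeasurable_sum.
- by move=> w _; exact: sume_ge0.
rewrite ge0_integralZl//; last exact: m1.
(* The convention [+oo * 0 = 0] makes the null event contribute nothing. *)
rewrite integral_indic// setIT [X in (+oo * X)%E]PN mule0 adde0.
rewrite ge0_integral_sum// mulr_sumr -sumEFin; apply: lee_sum => e _.
rewrite ge0_integralZl ?lee_fin//; last exact: m1.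
by rewrite integral_indic// setIT [X in (_ * X)%E]probability_event mulrC.
Qed.
End RademacherPatterns.

(** The average over patterns factors over the coordinates; [expR_half_sum_le] bounds each factor at
    [v * a i], whose square is [v ^+ 2]. *)
Lemma sign_mgf_le (R : realType) (n : nat) (a : 'I_n -> R) (v : R) :
  (forall i, a i ^+ 2 = 1) ->
  2^-1 ^+ n * (\sum_(e : {ffun 'I_n -> bool})
    expR (v * \sum_i (-1) ^+ e i * a i)) <= expR (n%:R * (v ^+ 2 / 2)).
Proof.
move=> a2; under eq_bigr do rewrite mulr_sumr expR_sum.
rewrite -(bigA_distr_bigA (fun i (b : bool) => expR (v * ((-1) ^+ b * a i)))).
rewrite mulrC -ler_pdivlMr ?exprn_gt0// -exprVn invrK mulrC expRM_natl.
rewrite -exprMn -[X in _ ^+ X]card_ord -prodr_const.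
apply: ler_prod => i _; rewrite big_bool addr_ge0 ?expR_ge0//= expr0 expr1.
rewrite mul1r mulN1r mulrN addrC (le_trans (expR_half_sum_le _))//.
by rewrite exprMn a2 mulr1.
Qed.

Section MaximalInequality.
Context (R : realType) (n : nat) (T : finType) (a : T -> 'I_n -> R).
Hypothesis a_sign : forall t i, a t i ^+ 2 = 1.
Implicit Types (e : {ffun 'I_n -> bool}) (u L : R).

Let corr t e : R := \sum_i (-1) ^+ e i * a t i.

(* From [x - L <= expR (x - L) - 1] at [x = u * |corr t e|], summed over [t]
   and over both signs so as not to depend on [t]. *)
Definition exp_majorant u L e : R := L + (\sum_t
  (expR (u * corr t e) + expR (- u * corr t e))) * expR (- L) - 1.

Lemma le_exp_majorant u L t e : 0 <= u ->
  u * `|corr t e| <= exp_majorant u L e.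
Proof.
move=> u0; set x := u * _.
have : expR x <= \sum_t (expR (u * corr t e) + expR (- u * corr t e)).
  rewrite (bigD1 t)//= -[leLHS]addr0 lerD//; last first.
    by apply: sumr_ge0 => t1 _; rewrite addr_ge0 ?expR_ge0.
  rewrite /x; case: (ger0P (corr t e)) => _; first by rewrite lerDl expR_ge0.
  by rewrite mulrN -mulNr lerDr expR_ge0.
rewrite -(ler_pM2r (expR_gt0 (- L))) -expRD => le_sum.
by have := le_trans (expR_ge1Dx _) le_sum; rewrite /exp_majorant; lra.
Qed.

(** Each [t] contributes two moment generating functions, at [u] and [- u], whence the factor
    [2 * #|T|]. *)
Lemma exp_majorant_mean_le u L :
  2^-1 ^+ n * (\sum_e exp_majorant u L e) <=
  L + (2 * #|T|)%:R * expR (n%:R * (u ^+ 2 / 2) - L) - 1.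
Proof.
set B := fun e => \sum_t (expR (u * corr t e) + expR (- u * corr t e)).
have mean_B : 2^-1 ^+ n * (\sum_e B e) <=
    (2 * #|T|)%:R * expR (n%:R * (u ^+ 2 / 2)).
  rewrite exchange_big/= mulr_sumr mulnC natrM -mulrA mulr_natl -sumr_const.
  apply: ler_sum => t _; rewrite big_split/= mulrDr mulr2n mulrDl !mul1r lerD//.
    exact: sign_mgf_le.
  by rewrite -[u ^+ 2]sqrrN; exact: sign_mgf_le.
rewrite (eq_bigr (fun e => L - 1 + B e * expR (- L))) => [|e _]; last first.
  by rewrite addrAC.
rewrite big_split/= -mulr_suml sumr_const card_ffun card_bool card_ord.
rewrite -[_ *+ (2 ^ n)]mulr_natr natrX.
have pow2 : 2^-1 ^+ n * 2 ^+ n = 1 :> R by rewrite -exprMn mulVf// expr1n.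
rewrite mulrDr mulrCA pow2 mulr1 expRD addrAC lerD2r lerD2l !mulrA.
by move: mean_B; rewrite !mulrA => mean_B; rewrite ler_wpM2r// expR_ge0.
Qed.
End MaximalInequality.

(** A sublevel set of a seminorm is convex, so it contains the hull as soon as it contains the
    generators. *)
Lemma sign_tensor_hull_le (R : realType) (p : nat) (r : 'I_p -> nat)
    (lambda : R) (n : nat) (a : 'I_n -> R) (X : 'I_n -> multi_index r) (M : R) :
  (forall psi, sign_tensors r lambda psi -> `|\sum_i a i * psi (X i)| <= M) ->
  forall psi, sign_tensor_hull r lambda psi -> `|\sum_i a i * psi (X i)| <= M.
Proof.
move=> sM; apply: (smallest_sub _ sM) => x y l; rewrite !inE /= => xM yM.
pose z : tensor R r :=
  l%:num *: (x : tensor R r) + (1 - l%:num) *: (y : tensor R r).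
rewrite -[conv l x y]/z.
have -> : \sum_i a i * z (X i) =
    l%:num * (\sum_i a i * x (X i)) + (1 - l%:num) * (\sum_i a i * y (X i)).
  rewrite !mulr_sumr -big_split/=; apply: eq_bigr => i _.
  by rewrite !ffunE /GRing.scale /=; ring.
have l1 : 0 <= 1 - l%:num by rewrite subr_ge0.
rewrite (le_trans (ler_normD _ _))// !normrM (ger0_norm l1) [`|_%:num|]ger0_norm//.
have -> : M = l%:num * M + (1 - l%:num) * M by ring.
by rewrite lerD// ler_wpM2l.
Qed.

Theorem proposition6 (R : realType) (p : nat) (r : 'I_p -> nat)
    (p_gt0 : (0 < p)%N) (r_gt0 : forall k : 'I_p, (0 < r k)%N)
    (lambda : R) (lambda_ge0 : 0 <= lambda) (n : nat) (n_gt0 : (0 < n)%N)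
    (d : measure_display) (Omega : measurableType d)
    (P : probability Omega R) (sigma : 'I_n -> {RV P >-> R})
    (sigma_iid : iid_rademacher sigma)
    (X : 'I_n -> multi_index r) :
  let rho := (\sum_(k < p) r k)%N in
  let C := sign_tensor_hull r lambda in
  (rademacher_complexity sigma C X <= worst_case_complexity sigma C)%E /\
  (worst_case_complexity sigma C <=
     (2 * lambda * Num.sqrt (rho%:R / n%:R))%:E)%E.
Proof.
move=> rho C; split; first by apply: ereal_sup_ubound; exists X.
apply: ge_ereal_sup => _ [{}X _ <-].
(* Positivity makes [u] invertible, and [1 <= rho] later absorbs the extra factor 2 in
   [2 ^ rho.+1]. *)
have rho_gt0 : (0 < rho)%N.
  by rewrite /rho (bigD1 (Ordinal p_gt0))//= ltn_addr// r_gt0.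
(* One bit for each pair of a mode [k] and an index in ['I_(r k)]: a pattern encodes all the sign
   vectors [theta k] at once. *)
pose T := {ffun {k : 'I_p & 'I_(r k)} -> bool}.
have card_T : #|T| = (2 ^ rho)%N.
  rewrite card_ffun card_bool card_tagged sumnE big_map big_enum/=.
  by congr (2 ^ _)%N; apply: eq_bigr => k _; rewrite card_ord.
pose a (t : T) i : R := \prod_(k < p) (-1) ^+ t (Tagged _ (X i k)).
have a_sign t i : a t i ^+ 2 = 1.
  by rewrite -prodrXl big1// => k _; rewrite sqrr_sign.
set q := Num.sqrt (rho%:R / n%:R).
have nR : 0 < n%:R :> R by rewrite ltr0n.
have rhoR : 0 < rho%:R :> R by rewrite ltr0n.
have q0 : 0 < q by rewrite sqrtr_gt0 divr_gt0.
have q2 : n%:R * q ^+ 2 = rho%:R.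
  by rewrite sqr_sqrtr ?divr_ge0// mulrC divfK// gt_eqF.
pose u := 2 * q; have u0 : 0 < u by rewrite mulr_gt0.
pose L : R := 4 * rho%:R.
pose c := exp_majorant a u L.
have c_ge t (e : {ffun 'I_n -> bool}) : u * `|\sum_i (-1) ^+ e i * a t i| <= c e.
  exact/le_exp_majorant/ltW.
(* Division by [u] recovers the correlation from its majorant [c]; the rest is the scale
   [lambda / n] of the complexity. *)
pose K : R := n%:R^-1 * lambda / u.
have K0 : 0 <= K by rewrite !mulr_ge0// ?invr_ge0 ltW.
apply: (@le_trans _ _ (2^-1 ^+ n * \sum_e K * c e)%:E).
  apply: (rademacher_integral_le sigma_iid) => [e|w e sigma_w].
    by rewrite mulr_ge0// (le_trans _ (c_ge [ffun=> false] e))// mulr_ge0// ltW.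
  apply: ge_ereal_sup => _ [psi Cpsi <-]; rewrite lee_fin /K -!mulrA.
  rewrite ler_wpM2l ?invr_ge0 ?ler0n//.
  apply: sign_tensor_hull_le Cpsi => {}psi [theta [theta_sign psiE]].
  (* [true] marks the sign -1, in accordance with [(-1) ^+ true]. *)
  pose t : T := [ffun kx => theta (tag kx) (tagged kx) == -1].
  have -> : \sum_i sigma i w * psi (X i) =
      lambda * \sum_i (-1) ^+ e i * a t i.
    rewrite mulr_sumr; apply: eq_bigr => i _; rewrite sigma_w psiE mulrCA.
    congr (_ * (_ * _)); apply: eq_bigr => k _; rewrite ffunE/=.
    case: (theta_sign k (X i k)) => ->; first by rewrite eqxx.
    by rewrite -addr_eq0 (_ : 1 + 1 = 2%:R)// pnatr_eq0.
  rewrite normrM ger0_norm// ler_wpM2l// mulrC ler_pdivlMr// mulrC.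
  exact: c_ge.
rewrite lee_fin -mulr_sumr mulrCA.
apply: (@le_trans _ _ (K * L)).
  apply: ler_wpM2l => //; apply: le_trans (exp_majorant_mean_le a_sign u L) _.
  rewrite -addrA gerDl subr_le0 card_T -expnS natrX.
  (* Since [2 <= expR 1], the whole exponent is at most [rho + 1 - 2 * rho], which is
     nonpositive. *)
  apply: (@le_trans _ _ (expR 1 ^+ rho.+1 * expR (n%:R * (u ^+ 2 / 2) - L))).
    rewrite ler_wpM2r ?expR_ge0// lerXn2r ?nnegrE ?expR_ge0//.
    by have := expR_ge1Dx (1 : R); lra.
  have -> : n%:R * (u ^+ 2 / 2) - L = - (2 * rho%:R).
    by rewrite /L -q2 /u; field.
  rewrite -expRM_natl -expRD -[leRHS]expR0 ler_expR mulr1 -natr1.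
  by have : 1 <= rho%:R :> R by [rewrite ler1n]; lra.
have -> : K * L = 2 * lambda * q; last by [].
by rewrite /K /L /u -q2; field; rewrite !gt_eqF.
Qed.
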